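(* (i) There exists an infinite set $\mathcal{A} \subset \mathbb{N}_0$ whose natural density exists and equals $0$, such that $r_1(\mathcal{A}, n) \leqslant r_1(\mathcal{A}, n+1)$ holds for almost all $n \in \mathbb{N}$. (ii) There exists a set $\mathcal{A} \subset \mathbb{N}_0$ such that $\mathbb{N}_0 \setminus \mathcal{A}$ is infinite and $r_1(\mathcal{A}, n) < r_1(\mathcal{A}, n+1)$ holds for almost all $n \in \mathbb{N}$.
   Context: $\mathbb{N} = \{1,2,3,\dots\}$ and $\mathbb{N}_0 = \mathbb{N} \cup \{0\}$. For $\mathcal{A} \subset \mathbb{N}_0$ and $n \in \mathbb{N}_0$, $r_1(\mathcal{A}, n)$ denotes the number of ordered pairs $(a,b) \in \mathcal{A} \times \mathcal{A}$ with $a + b = n$. The natural density of $\mathcal{A}$ is $\lim_{N \to \infty} \mathrm{card}(\mathcal{A} \cap \{1,\dots,N\})/N$ (when it exists). A property holds for almost all $n \in \mathbb{N}$ if the set of $n \in \mathbb{N}$ for which it holds has natural density $1$. *)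

(* Defs.v *)
From mathcomp Require Import all_boot all_order all_algebra finmap.
From mathcomp Require Import all_classical all_reals all_analysis.

Set Implicit Arguments.
Unset Strict Implicit.
Unset Printing Implicit Defensive.

Import Order.TTheory GRing.Theory Num.Theory.
Import numFieldNormedType.Exports.

Local Open Scope classical_set_scope.

(* [fset_set] sends an infinite set to the empty one, hence the two finiteness
   lemmas: each cardinality taken below is that of a genuinely finite set. *)

Definition reprs (A : set nat) (n : nat) : set (nat * nat) :=
  [set p | A p.1 /\ A p.2 /\ (p.1 + p.2)%N = n].

Lemma finite_reprs (A : set nat) (n : nat) : finite_set (reprs A n).
Proof.
apply: (@sub_finite_set _ _ (`I_n.+1 `*` `I_n.+1)).
  move=> [a b] [_ [_ /= <-]]; split => /=; rewrite ltnS.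
    exact: leq_addr.
  exact: leq_addl.
by apply: finite_setX; exact: finite_II.
Qed.

Definition r1 (A : set nat) (n : nat) : nat := #|` fset_set (reprs A n)|%fset.

Definition initial_part (A : set nat) (N : nat) : set nat :=
  A `&` [set k | (1 <= k <= N)%N].

Lemma finite_initial_part (A : set nat) (N : nat) :
  finite_set (initial_part A N).
Proof.
apply: (@sub_finite_set _ _ `I_N.+1); last exact: finite_II.
by move=> k [_ /= /andP[_]]; rewrite ltnS.
Qed.

Definition count_upto (A : set nat) (N : nat) : nat :=
  #|` fset_set (initial_part A N)|%fset.

Definition has_natural_density (R : realType) (A : set nat) (d : R) : Prop :=
  ((count_upto A N)%:R / N%:R : R)%R @[N --> \oo] --> d.

Definition almost_all (R : realType) (P : nat -> Prop) : Prop :=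
  has_natural_density [set n | (0 < n)%N /\ P n] (1 : R)%R.

(* Main.v *)
Require Import Defs.
From mathcomp Require Import all_boot all_order all_algebra finmap.
From mathcomp Require Import all_classical all_reals all_analysis.
From mathcomp Require Import zify.

(** Let B be the set of powers of 2, a set so sparse that B + B has only
    polylogarithmically many elements up to N. For (i), take A = B: r1(B, n)
    vanishes off B + B. For (ii), take A to be the complement of B: by
    inclusion-exclusion
    r1(A, n) = n + 1 - 2 card (B \cap [0, n]) + r1(B, n), so that
    r1(A, n) < r1(A, n + 1) as soon as n is not in B + B and n + 1 is not
    in B. *)

Set Implicit Arguments.
Unset Strict Implicit.
Unset Printing Implicit Defensive.

Import Order.TTheory GRing.Theory Num.Theory.
Import numFieldNormedType.Exports.

Local Open Scope classical_set_scope.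
Local Open Scope nat_scope.

(** Bridge from cardinalities of classical sets to lengths of duplicate-free lists. *)
Lemma card_fset_set_seq (T : choiceType) (A : set T) (s : seq T) :
  uniq s -> (forall x, A x <-> x \in s) -> #|` fset_set A|%fset = size s.
Proof.
move=> us As; have -> : A = [set` s] by apply/seteqP; split=> x /= /As.
have -> : fset_set [set` s] = [fset x in s]%fset.
  by apply/fsetP=> x; rewrite in_fset_set// mem_setE !inE.
by rewrite card_fseq undup_id.
Qed.

Lemma count_uptoE (A : set nat) (N : nat) :
  count_upto A N = count (mem A) (iota 1 N).
Proof.
rewrite -size_filter; apply: card_fset_set_seq.
  by rewrite filter_uniq ?iota_uniq.
move=> k; rewrite mem_filter mem_iota add1n ltnS; split.
  by move=> [Ak kN]; apply/andP; split=> //; rewrite inE.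
by move=> /andP[]; rewrite inE.
Qed.

(** A pair of sum [n] is determined by its first entry [i <= n], so the truncated [n - i] is
    exact. *)
Lemma r1E (A : set nat) (n : nat) :
  r1 A n = \sum_(i < n.+1) ((val i \in A) && (n - i \in A)).
Proof.
pose s := [seq (i, n - i) | i <- iota 0 n.+1 & (i \in A) && (n - i \in A)].
rewrite /r1 (@card_fset_set_seq _ _ s).
- rewrite size_map size_filter -sum1_count big_mkcond.
  rewrite -[iota 0 n.+1]/(index_iota 0 n.+1) big_mkord.
  by apply: eq_bigr => i _; case: ifP.
- by rewrite map_inj_uniq ?filter_uniq ?iota_uniq// => i j [].
move=> [a b]; split.
  move=> [] /= Aa [Ab abn]; apply/mapP; exists a; last by rewrite -abn addKn.
  rewrite mem_filter -abn addKn mem_iota ltnS leq_addr/= andbT.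
  by apply/andP; rewrite !inE.
move=> /mapP[i]; rewrite mem_filter mem_iota ltnS.
move=> /andP[/andP[+ +] /= lein] [-> ->].
rewrite !inE => Ai Ani.
by split=> //=; split=> //; rewrite subnKC.
Qed.

Lemma r1_eq0 (B : set nat) (n : nat) :
  (forall a b, B a -> B b -> a + b != n) -> r1 B n = 0.
Proof.
move=> nBB; rewrite r1E big1// => i _.
case: andP => //= -[]; rewrite !inE => Bi /(nBB _ _ Bi).
by rewrite subnKC ?eqxx //; exact: ltn_ord i.
Qed.

Section complement.
Variable B : set nat.

Let cnt n := \sum_(i < n.+1) (val i \in B).

(** Of the two copies of [cnt n] below, one is reversed, so that the sums merge term by term over
    the pairs [(i, n - i)]. *)
Let cnt_rev n : cnt n = \sum_(i < n.+1) (n - i \in B).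
Proof. by rewrite /cnt (reindex_inj rev_ord_inj). Qed.

(** For each [i <= n], either both [i] and [n - i] avoid [B], or at least one of them lies in
    [B]. *)
Lemma r1_setC_ge (n : nat) : n.+1 <= r1 (~` B) n + (cnt n + cnt n).
Proof.
rewrite r1E [in X in _ + (_ + X)]cnt_rev -!big_split /=.
rewrite -[X in X <= _]card_ord -sum1_card.
apply: leq_sum => i _; rewrite !in_setC.
by case: (val i \in B); case: (n - i \in B).
Qed.

(** Now [i] and [n - i] are never both in [B], so each [i] contributes exactly 1. *)
Lemma r1_setC (n : nat) : (forall a b, B a -> B b -> a + b != n) ->
  r1 (~` B) n + (cnt n + cnt n) = n.+1.
Proof.
move=> nBB.
rewrite r1E [in X in _ + (_ + X)]cnt_rev -!big_split /=.
rewrite -[RHS]card_ord -sum1_card.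
apply: eq_bigr => i _; rewrite !in_setC.
have : ~~ ((val i \in B) && (n - i \in B)).
  apply/andP=> -[]; rewrite !inE => Bi /(nBB _ _ Bi).
  by rewrite subnKC ?eqxx //; exact: ltn_ord i.
by case: (val i \in B); case: (n - i \in B).
Qed.

(** The equality at [n] meets the lower bound at [n.+1] with the same [cnt]; hence [n.+1] may be a
    sum of two elements of [B]. *)
Lemma r1_setC_lt (n : nat) : (forall a b, B a -> B b -> a + b != n) ->
  ~ B n.+1 -> r1 (~` B) n < r1 (~` B) n.+1.
Proof.
move=> nBB nB; have := r1_setC nBB; have := r1_setC_ge n.+1.
have -> : cnt n.+1 = cnt n by rewrite /cnt big_ord_recr/= memNset ?addn0.
by lia.
Qed.

End complement.

Lemma natural_density0S (R : realType) (A B : set nat) : A `<=` B ->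
  has_natural_density B (0 : R)%R -> has_natural_density A (0 : R)%R.
Proof.
move=> AB; apply: squeeze_cvgr; last exact: cvg_cst.
apply: nearW => N; rewrite divr_ge0//= ler_wpM2r ?invr_ge0// ler_nat.
rewrite !count_uptoE.
by apply: sub_count => k; rewrite !inE; exact: AB.
Qed.

Lemma almost_all_density0 (R : realType) (P : nat -> Prop) (B : set nat) :
  (forall n, 0 < n -> ~ B n -> P n) -> has_natural_density B (0 : R)%R ->
  almost_all R P.
Proof.
move=> nBP B0; set E := [set n | 0 < n /\ P n].
(* [E] omits 0, which [B] need not contain; adjoining 0 changes no count, as counting starts at
   1. *)
have EB : ~` (E `|` [set 0]) `<=` B.
  move=> n /not_orP[nE /eqP n0]; apply: contrapT => nB; apply: nE.
  by split; [rewrite lt0n | apply: nBP => //; rewrite lt0n].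
have c1 : (fun=> 1%R : R) @ \oo --> (1%R : R) by exact: cvg_cst.
have := cvgB c1 (natural_density0S EB B0); rewrite subr0 => c2.
rewrite /almost_all /has_natural_density; apply: cvg_trans (c2 _).
apply: near_eq_cvg; near=> N.
have N0 : (N%:R != 0 :> R)%R.
  by rewrite pnatr_eq0 -lt0n; near: N; exact: nbhs_infty_ge.
rewrite !fctE -[X in (X - _)%R](divff N0) -mulrBl; congr (_ / _)%R.
apply/eqP; rewrite subr_eq -natrD; apply/eqP; congr (_%:R)%R.
rewrite !count_uptoE -{1}(size_iota 1 N) -(count_predC (mem E)); congr (_ + _).
apply: eq_in_count => k; rewrite mem_iota /= => /andP[k0 _].
rewrite in_setC; congr (~~ _); apply/idP/idP; rewrite !inE; first by left.
by case=> // k00; rewrite k00 in k0.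
Unshelve. all: end_near. Qed.

Lemma cube_le_expn2 (l : nat) : l.+1 ^ 3 <= 8 * 2 ^ l.
Proof.
(* The induction starts at [l = 3], where equality holds: only from there on does the cube at most
   double at each step. *)
case: l => [|[|[|]]] //; elim=> // l IH.
by rewrite [2 ^ l.+4]expnS !expnS !expn0 in IH *; nia.
Qed.

(** With L = [(trunc_log 2 N).+1], the count is at most c L^2, while L^3 <= 8 N; hence the ratio is
    at most 8 c / L, which tends to 0. The list [s N] may have repetitions and extra terms. *)
Lemma polylog_density0 (R : realType) (A : set nat) (c : nat)
    (s : nat -> seq nat) :
  (forall N k, A k -> 0 < k <= N -> k \in s N) ->
  (forall N, 0 < N -> size (s N) <= c * (trunc_log 2 N).+1 ^ 2) ->
  has_natural_density A (0 : R)%R.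
Proof.
move=> As sz.
have bound N : 0 < N -> count_upto A N * (trunc_log 2 N).+1 <= c * 8 * N.
  move=> N0; have : count_upto A N <= c * (trunc_log 2 N).+1 ^ 2.
    apply: leq_trans (sz N N0); rewrite count_uptoE -size_filter.
    apply: uniq_leq_size; first by rewrite filter_uniq ?iota_uniq.
    move=> k; rewrite mem_filter mem_iota add1n ltnS => /andP[/set_mem Ak kN].
    exact: As.
  move=> le1; apply: leq_trans (_ : c * (trunc_log 2 N).+1 ^ 3 <= _).
    by rewrite [_ ^ 3]expnSr mulnA leq_mul2r le1 orbT.
  rewrite -mulnA leq_mul2l (leq_trans (cube_le_expn2 _)) ?orbT//.
  by rewrite leq_mul2l trunc_logP.
apply/cvgrPdist_le => e e0.
(* Once [N >= 2 ^ m], L is at least [m.+1], which exceeds 8 c / e. *)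
pose m := Num.truncn ((c * 8)%:R / e)%R.
near=> N.
have N2 : 2 ^ m <= N by near: N; exact: nbhs_infty_ge.
have N0 : 0 < N by apply: leq_trans N2; rewrite expn_gt0.
rewrite sub0r normrN ger0_norm ?divr_ge0// ler_pdivrMr ?ltr0n//.
have := bound N N0; rewrite -(ler_nat R) !natrM => /le_trans H.
have m0 : ((c * 8)%:R <= (trunc_log 2 N).+1%:R * e :> R)%R.
  rewrite -ler_pdivrMr// (le_trans (ltW (truncnS_gt _)))// ler_nat ltnS.
  exact: trunc_log_max.
have t0 : (0 < (trunc_log 2 N).+1%:R :> R)%R by rewrite ltr0n.
rewrite -(ler_pM2r t0); apply: H.
by rewrite -natrM mulrAC [(e * _)%R]mulrC ler_wpM2r.
Unshelve. all: end_near. Qed.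

Definition pow2 : set nat := range (expn 2).

Lemma infinite_pow2 : infinite_set pow2.
Proof.
move=> /(finite_preimage (in2W (@expnI 2 isT))).
apply: sub_infinite_set infinite_nat.
by move=> i _; exists i.
Qed.

(** One exceptional set serves both parts; the condition on [n.+1] matters only for the
    complement. *)
Lemma sparse_pow2 (R : realType) :
  has_natural_density
    [set n | pow2 n \/ pow2 n.+1 \/ exists a b, [/\ pow2 a, pow2 b & a + b = n]]
    (0 : R)%R.
Proof.
pose r N := iota 0 (trunc_log 2 N).+1.
(* The middle list has one more exponent, since [2 ^ i] may be as large as [N.+1] there. The total
   length L + (L + 1) + L^2 is at most 4 L^2, whence the constant 4. *)
pose s N := map (expn 2) (r N)
  ++ map (fun i => (2 ^ i).-1) (iota 0 (trunc_log 2 N).+2)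
  ++ [seq 2 ^ i + 2 ^ j | i <- r N, j <- r N].
have mem_r N i : 2 ^ i <= N -> i \in r N.
  by move=> iN; rewrite mem_iota ltnS/= trunc_log_max.
apply: (@polylog_density0 R _ 4 s) => [N k Ak /andP[k0 kN]|N N0].
  rewrite 2!mem_cat.
  case: Ak => [[i _ ik]|[[i _ ik]|[_ [_ [[i _ <-] [j _ <-] ijk]]]]].
  - by rewrite -ik map_f// mem_r// ik.
  - apply/orP; right; apply/orP; left; apply/mapP; exists i; last by rewrite ik.
    rewrite mem_iota/= add0n ltnS; case: i ik => // i ik.
    by rewrite ltnS trunc_log_max//; rewrite expnS in ik; lia.
  - do 2 (apply/orP; right); apply/allpairsPdep; exists i, j.
    by split=> //=; apply: mem_r; lia.
by rewrite 2!size_cat size_allpairs !size_map !size_iota expnS expn1; nia.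
Qed.

Theorem theorem1p1 (R : realType) :
  (exists A : set nat,
      infinite_set A /\
      has_natural_density A (0 : R)%R /\
      almost_all R (fun n => (r1 A n <= r1 A n.+1)%N)) /\
  (exists A : set nat,
      infinite_set (~` A)%classic /\
      almost_all R (fun n => (r1 A n < r1 A n.+1)%N)).
Proof.
have offsum n :
    ~ (pow2 n \/ pow2 n.+1 \/ exists a b, [/\ pow2 a, pow2 b & a + b = n]) ->
    forall a b, pow2 a -> pow2 b -> a + b != n.
  move=> nbad a b Ba Bb; apply/eqP => abn; apply: nbad.
  by right; right; exists a, b.
split; [exists pow2|exists (~` pow2)].
  split; first exact: infinite_pow2.
  split; first by apply: (natural_density0S _ (@sparse_pow2 R)) => n; left.
  apply: (almost_all_density0 _ (@sparse_pow2 R)) => n _ /offsum nBB.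
  (* The left side is 0, so nothing is required of [n.+1]. *)
  by rewrite r1_eq0.
split; first by rewrite setCK; exact: infinite_pow2.
apply: (almost_all_density0 _ (@sparse_pow2 R)) => n _ nbad.
by apply: r1_setC_lt (offsum _ nbad) _ => Bn; apply: nbad; right; left.
Qed.
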